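(* Let $f,g$ be arithmetical functions whose Dirichlet series $F(s)=\sum_{k\ge1}f(k)k^{-s}$ and $G(s)=\sum_{k\ge1}g(k)k^{-s}$ converge absolutely for $\Re(s)>\sigma_1$ and $\Re(s)>\sigma_2$ respectively, and suppose $U_{f,g}(s)=\sum_{k\ge1}u_{f,g}(k)k^{-s}$ converges absolutely for $\Re(s)>\alpha$. Then $G_L(s):=\sum_{k\ge1}g(k)L(k)k^{-s}$ converges absolutely for $\Re(s)>\sigma_2+1$, and for $\Re(s)>\max\{\alpha,\sigma_1,\sigma_2+1\}$, $$U_{f,g}(s)=-F'(s)G(s-1)+F(s)G_L(s).$$
   Context: For positive integers $k,j$, $s_k(j):=\sum_{d\mid\gcd(k,j)}f(d)g(k/d)$ (Anderson–Apostol sum), and $u_{f,g}(k):=\sum_{j=1}^{k}s_k(j)\log j$. $L(k):=\sum_{m=1}^{k}\log m$. $F'$ denotes the derivative of $F$ with respect to $s$. *)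

(* Defs.v *)
From Stdlib Require Export Reals Arith.
From Coquelicot Require Export Coquelicot.

Open Scope C_scope.

Definition Cexp (z : C) : C :=
  (exp (Re z) * cos (Im z), exp (Re z) * sin (Im z))%R.

(** [n ^ z] for a positive integer [n], with the real logarithm of [n]. *)
Definition nat_cpow (n : nat) (z : C) : C := Cexp (z * RtoC (ln (INR n))).

(** Like [Series], this is only meaningful for a convergent series: see
    [CSeries_correct]. *)
Definition CSeries (a : nat -> C) : C :=
  (Series (fun n => Re (a n)), Series (fun n => Im (a n))).

Lemma CSeries_correct (a : nat -> C) (l : C) :
  @is_series C_AbsRing C_NormedModule a l -> CSeries a = l.
Proof.
  intros H.
  assert (E : forall n, sum_n a n
     = (sum_n (fun k => Re (a k)) n, sum_n (fun k => Im (a k)) n)).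
  { induction n as [|n IH].
    - rewrite !sum_O. destruct (a O); reflexivity.
    - rewrite !sum_Sn, IH. reflexivity. }
  destruct l as [x y]; unfold CSeries; f_equal; apply is_series_unique.
  - intros P [e He].
    destruct (H (fun z => P (fst z))) as [N HN].
    { exists e. intros z [Hz _]. now apply He. }
    exists N. intros n Hn. specialize (HN n Hn). now rewrite E in HN.
  - intros P [e He].
    destruct (H (fun z => P (snd z))) as [N HN].
    { exists e. intros z [_ Hz]. now apply He. }
    exists N. intros n Hn. specialize (HN n Hn). now rewrite E in HN.
Qed.

(** An arithmetical function is a map [nat -> C] whose value at [0] is never
    used: the [n]-th term of the series is the one of index [k = S n]. *)
Definition dirichlet_term (a : nat -> C) (s : C) (n : nat) : C :=
  a (S n) * nat_cpow (S n) (- s).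

Definition dirichlet (a : nat -> C) (s : C) : C :=
  CSeries (dirichlet_term a s).

Definition dirichlet_abs_cv (a : nat -> C) (s : C) : Prop :=
  ex_series (fun n => Cmod (dirichlet_term a s n)).

(** Anderson-Apostol sum [s_k(j)]. *)
Definition anderson_apostol (f g : nat -> C) (k j : nat) : C :=
  sum_n_m (fun d =>
    if Nat.eqb (Nat.modulo (Nat.gcd k j) d) 0
    then f d * g (Nat.div k d) else RtoC 0) 1 (Nat.gcd k j).

Definition u_sum (f g : nat -> C) (k : nat) : C :=
  sum_n_m (fun j => anderson_apostol f g k j * RtoC (ln (INR j))) 1 k.

Definition log_sum (k : nat) : R := sum_n_m (fun m => ln (INR m)) 1 k.

(* Main.v *)
Require Import Defs.
From Stdlib Require Import Lia Lra.

(** Writing [j = d m] in the definition of [u_sum] and using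
    [ln (d m) = ln d + ln m] gives, with [*] the Dirichlet convolution,
    [u_sum f g = (f ln) * (g id) + f * (g L)]. The identity follows since the
    Dirichlet series of a convolution is the product of the Dirichlet series,
    the series of [f ln] is [- F'], and that of [g id] at [s] is [G (s - 1)]. *)

(* Equations between complex sums are typed in a Coquelicot structure with
   carrier [C], which [ring] does not recognize. *)
Ltac C_ring := match goal with |- ?x = ?y => change (@eq C x y) end; ring.

(** * Finite sums over divisors and the decomposition of [u_sum] *)

Lemma sum_n_m_switch {G : AbelianMonoid} (u : nat -> nat -> G) (N M : nat) :
  sum_n_m (fun i => sum_n_m (u i) 1 M) 1 N
  = sum_n_m (fun j => sum_n_m (fun i => u i j) 1 N) 1 M.
Proof.
  (* Ranges from 1 are shifted to ranges from 0, which is possible only when they are nonempty; the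
     bound 0 is treated apart. *)
  destruct N as [|N]; [|destruct M as [|M]].
  - rewrite sum_n_m_zero by lia.
    rewrite <- (sum_n_m_const_zero 1 M); apply sum_n_m_ext; intro j.
    now rewrite sum_n_m_zero by lia.
  - rewrite (sum_n_m_zero _ 1 0) by lia.
    rewrite <- (sum_n_m_const_zero 1 (S N)); apply sum_n_m_ext; intro j.
    now rewrite sum_n_m_zero by lia.
  - rewrite <- !sum_n_m_S.
    rewrite (sum_n_m_ext _ (fun i => sum_n (fun j => u (S i) (S j)) M))
      by (intro i; now rewrite <- sum_n_m_S).
    rewrite (sum_n_m_ext (fun j => sum_n_m _ _ _)
      (fun j => sum_n (fun i => u (S i) (S j)) N))
      by (intro i; now rewrite <- sum_n_m_S).
    exact (sum_n_switch (fun i j => u (S i) (S j)) N M).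
Qed.

(** Induction on [N]: the quotient [N / d] grows by one exactly when the new index is a multiple of
    [d], and the new index is then [d] times the new quotient. *)
Lemma sum_n_m_multiples {G : AbelianMonoid} (h : nat -> G) (d N : nat) :
  (1 <= d)%nat ->
  sum_n_m (fun n => if Nat.eqb (n mod d) 0 then h n else zero) 1 N
  = sum_n_m (fun m => h (d * m)%nat) 1 (N / d).
Proof.
  intro Hd. induction N as [|N IH].
  - rewrite Nat.Div0.div_0_l, !sum_n_m_zero by lia. reflexivity.
  - rewrite sum_n_Sm, IH by lia.
    assert (E1 := Nat.div_mod_eq N d). assert (E2 := Nat.div_mod_eq (S N) d).
    assert (L1 := Nat.mod_upper_bound N d). assert (L2 := Nat.mod_upper_bound (S N) d).
    destruct (Nat.eqb_spec (S N mod d) 0) as [E|E].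
    + assert (Q : (S N / d = S (N / d))%nat) by nia.
      rewrite Q, sum_n_Sm by lia. rewrite <- Q.
      replace (d * (S N / d))%nat with (S N) by lia. reflexivity.
    + assert (Q : (S N / d = N / d)%nat) by nia.
      now rewrite Q, plus_zero_r.
Qed.

(** This separates the variables: once the sums over [j] and [d] are exchanged, the test on [k] is
    constant in the inner sum and the test on [j] selects the multiples of [d]. *)
Lemma eqb_mod_gcd (k j d : nat) : (1 <= d)%nat ->
  Nat.eqb (Nat.gcd k j mod d) 0 = andb (Nat.eqb (k mod d) 0) (Nat.eqb (j mod d) 0).
Proof.
  intro Hd. apply Bool.eq_iff_eq_true.
  rewrite Bool.andb_true_iff, !Nat.eqb_eq, !Nat.Lcm0.mod_divide.
  split.
  - intro H. split; (eapply Nat.divide_trans; [exact H|]).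
    + apply Nat.gcd_divide_l.
    + apply Nat.gcd_divide_r.
  - intros [H1 H2]. now apply Nat.gcd_greatest.
Qed.

Definition dirichlet_conv (a b : nat -> C) (n : nat) : C :=
  sum_n_m (fun d => if Nat.eqb (n mod d) 0 then a d * b (n / d)%nat else RtoC 0) 1 n.

(** The pairs [(d, m)] with [d m <= N] are grouped by [d], which leaves [m <= N / d]. *)
Lemma sum_dirichlet_conv (a b : nat -> C) (N : nat) :
  sum_n_m (dirichlet_conv a b) 1 N
  = sum_n_m (fun d => a d * sum_n_m b 1 (N / d)) 1 N.
Proof.
  transitivity (sum_n_m (fun n => sum_n_m
    (fun d => if Nat.eqb (n mod d) 0 then a d * b (n / d)%nat else RtoC 0) 1 N) 1 N).
  (* The range of [d] becomes independent of [n]: for [d > n] the remainder is [n] itself, which is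
     nonzero. *)
  { apply sum_n_m_ext_loc. intros n Hn. unfold dirichlet_conv.
    rewrite (sum_n_m_Chasles _ 1 n N) by lia.
    rewrite (sum_n_m_ext_loc _ (fun _ => zero) (S n) N).
    - now rewrite sum_n_m_const_zero, plus_zero_r.
    - intros d Hd. rewrite Nat.mod_small by lia.
      destruct n; [lia|reflexivity]. }
  rewrite sum_n_m_switch. apply sum_n_m_ext_loc. intros d Hd.
  etransitivity.
  - exact (sum_n_m_multiples (fun n => a d * b (n / d)%nat : C_AbelianMonoid)
      d N (proj1 Hd)).
  - rewrite <- (sum_n_m_mult_l (K := C_Ring)).
    apply sum_n_m_ext. intro m. rewrite Nat.mul_comm, Nat.div_mul by lia. reflexivity.
Qed.

Lemma u_sum_dirichlet_conv (f g : nat -> C) (k : nat) :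
  u_sum f g k
  = dirichlet_conv (fun d => f d * RtoC (ln (INR d))) (fun m => g m * RtoC (INR m)) k
    + dirichlet_conv f (fun m => g m * RtoC (log_sum m)) k.
Proof.
  unfold u_sum.
  transitivity (sum_n_m (fun j => sum_n_m (fun d =>
    if Nat.eqb (j mod d) 0
    then (if Nat.eqb (k mod d) 0 then f d * g (k / d)%nat else RtoC 0)
         * RtoC (ln (INR j))
    else zero) 1 k) 1 k).
  (* The range of [d] is extended from [gcd k j] to [k], so that it no longer depends on [j]. A
     larger [d] cannot divide the nonzero gcd, so it fails one of the two tests. *)
  { apply sum_n_m_ext_loc. intros j Hj. unfold anderson_apostol.
    assert (Hg : (Nat.gcd k j <= k)%nat)
      by (apply Nat.divide_pos_le; [lia|apply Nat.gcd_divide_l]).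
    assert (Hg0 : Nat.gcd k j <> 0%nat)
      by (intro E; apply Nat.gcd_eq_0_l in E; lia).
    rewrite <- (sum_n_m_mult_r (K := C_Ring) (RtoC (ln (INR j)))).
    rewrite (sum_n_m_Chasles _ 1 (Nat.gcd k j) k) by lia.
    rewrite (sum_n_m_ext_loc _ (fun _ => zero) (S (Nat.gcd k j)) k).
    - rewrite sum_n_m_const_zero, plus_zero_r.
      apply sum_n_m_ext_loc. intros d Hd. rewrite eqb_mod_gcd by lia.
      destruct (Nat.eqb (k mod d) 0), (Nat.eqb (j mod d) 0);
        cbn; try reflexivity; apply (mult_zero_l (K := C_Ring)).
    - intros d Hd.
      assert (E := eqb_mod_gcd k j d ltac:(lia)).
      rewrite (Nat.mod_small (Nat.gcd k j) d) in E by lia.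
      replace (Nat.eqb (Nat.gcd k j) 0) with false in E
        by (symmetry; now apply Nat.eqb_neq).
      destruct (Nat.eqb (k mod d) 0), (Nat.eqb (j mod d) 0);
        cbn in *; try reflexivity; try discriminate.
      apply (mult_zero_l (K := C_Ring)). }
  rewrite sum_n_m_switch. unfold dirichlet_conv.
  etransitivity; [|exact (sum_n_m_plus (G := C_AbelianMonoid) _ _ 1 k)].
  apply sum_n_m_ext_loc. intros d Hd.
  rewrite (sum_n_m_multiples (fun j =>
    (if Nat.eqb (k mod d) 0 then f d * g (k / d)%nat else RtoC 0)
    * RtoC (ln (INR j)) : C_AbelianMonoid) d k) by lia.
  etransitivity.
  { exact (sum_n_m_mult_l (K := C_Ring)
      (if Nat.eqb (k mod d) 0 then f d * g (k / d)%nat else RtoC 0)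
      (fun m => RtoC (ln (INR (d * m)))) 1 (k / d)). }
  destruct (Nat.eqb (k mod d) 0).
  2: { etransitivity; [apply (mult_zero_l (K := C_Ring))|].
       symmetry; apply (plus_zero_l (G := C_AbelianMonoid)). }
  (* For [q = k / d], the part [q ln d] yields the convolution of [f ln] with [g id], and
     [log_sum q] the one of [f] with [g L]. *)
  assert (E : forall q, sum_n_m (G := C_AbelianMonoid)
     (fun m => RtoC (ln (INR (d * m)))) 1 q
     = RtoC (INR q) * RtoC (ln (INR d)) + RtoC (log_sum q)).
  { intro q. unfold log_sum. induction q as [|q IH].
    - rewrite !sum_n_m_zero by lia. cbn [INR].
      change (RtoC 0 = RtoC 0 * RtoC (ln (INR d)) + RtoC 0). C_ring.
    - rewrite !sum_n_Sm, IH by lia.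
      rewrite mult_INR, ln_mult, !S_INR by (apply lt_0_INR; lia).
      change (@plus C_AbelianMonoid) with Cplus.
      change (@plus R_AbelianMonoid) with Rplus.
      rewrite !RtoC_plus. C_ring. }
  etransitivity; [exact (f_equal (Cmult _) (E (k / d)%nat))|].
  change (@plus C_AbelianMonoid) with Cplus.
  C_ring.
Qed.

(** * Complex series and the product theorem for Dirichlet convolution *)

Lemma sum_n_m_le_loc (a b : nat -> R) (n m : nat) :
  (forall k, (n <= k <= m)%nat -> (a k <= b k)%R) ->
  (sum_n_m a n m <= sum_n_m b n m)%R.
Proof.
  intro H.
  (* Replacing [a] by [b] outside the range leaves the sum unchanged and makes the inequality hold
     at every index. *)
  rewrite (sum_n_m_ext_loc a
    (fun k => if andb (Nat.leb n k) (Nat.leb k m) then a k else b k)).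
  - apply sum_n_m_le. intro k.
    destruct (Nat.leb_spec n k), (Nat.leb_spec k m); cbn; try apply Rle_refl.
    apply H; lia.
  - intros k [H1 H2]. apply Nat.leb_le in H1, H2. now rewrite H1, H2.
Qed.

Lemma is_series_Cmod_eps (a : nat -> C) (l : C) :
  @is_series C_AbsRing C_NormedModule a l <->
  forall eps : R, (0 < eps)%R ->
  exists N, forall n, (N <= n)%nat ->
    (Cmod (sum_n (G := C_AbelianMonoid) a n - l) < eps)%R.
Proof.
  split.
  - intros H eps Heps.
    apply (proj1 (filterlim_locally_ball_norm (U := C_NormedModule) _ _)) with (eps := mkposreal _ Heps) in H.
    exact H.
  - intros H. apply (proj2 (filterlim_locally_ball_norm (U := C_NormedModule) _ _)).
    intros [eps Heps]. exact (H eps Heps).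
Qed.

Lemma ex_series_Cmod (a : nat -> C) :
  ex_series (fun n => Cmod (a n)) ->
  @is_series C_AbsRing C_NormedModule a (CSeries a).
Proof.
  intro H.
  assert (E : @ex_series C_AbsRing C_NormedModule a).
  { apply (ex_series_le (V := C_CompleteNormedModule) a (fun n => Cmod (a n))); [|exact H].
    intro n. apply Rle_refl. }
  destruct E as [l Hl]. now rewrite (CSeries_correct a l Hl).
Qed.

(** If [Cmod l] exceeded [Series b], a partial sum of [a] closer to [l] than the gap would have
    modulus above [Series b], against the triangle inequality for finite sums. *)
Lemma is_series_Cmod_le (a : nat -> C) (l : C) (b : nat -> R) :
  @is_series C_AbsRing C_NormedModule a l ->
  (forall n, Cmod (a n) <= b n)%R -> ex_series b -> (Cmod l <= Series b)%R.
Proof.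
  intros Ha Hab Hb. apply Rnot_lt_le. intro Hlt.
  destruct (proj1 (is_series_Cmod_eps a l) Ha (Cmod l - Series b)%R ltac:(lra)) as [N HN].
  specialize (HN N (Nat.le_refl N)).
  assert (H1 : (Cmod (sum_n (G := C_AbelianMonoid) a N) <= sum_n b N)%R).
  { eapply Rle_trans; [exact (norm_sum_n_m (V := C_NormedModule) a 0 N)|].
    apply sum_n_m_le. exact Hab. }
  assert (H2 : (sum_n b N <= Series b)%R).
  { apply (is_lim_seq_incr_compare (sum_n b)); [exact (Series_correct b Hb)|].
    intro n. rewrite sum_Sn. specialize (Hab (S n)). pose proof (Cmod_ge_0 (a (S n))).
    change (@plus R_AbelianMonoid) with Rplus. lra. }
  assert (H3 := Cmod_triangle (sum_n (G := C_AbelianMonoid) a N)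
    (- (sum_n (G := C_AbelianMonoid) a N - l))).
  rewrite Cmod_opp in H3.
  replace (sum_n (G := C_AbelianMonoid) a N + - (sum_n (G := C_AbelianMonoid) a N - l))
    with l in H3 by ring.
  lra.
Qed.

(* The partial sums are [sum_(d <= N) a d * B_(N/d)] with [B_n] the bounded
   partial sums of [b]: cut the sum at a fixed [D] beyond which the tail of
   [sum |a|] is small, and let [N / d] go to infinity for [d <= D]. *)
Lemma is_series_dirichlet_conv (a b : nat -> C) (A B : C) :
  @is_series C_AbsRing C_NormedModule (fun n => a (S n)) A ->
  ex_series (fun n => Cmod (a (S n))) ->
  @is_series C_AbsRing C_NormedModule (fun n => b (S n)) B ->
  @is_series C_AbsRing C_NormedModule (fun n => dirichlet_conv a b (S n)) (A * B).
Proof.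
  intros HA HAa HB.
  (* The error of the partial sums of [b]: it tends to 0 and is therefore bounded, by [K] below. *)
  set (Bp := fun n => sum_n_m (G := C_AbelianMonoid) b 1 n - B).
  assert (HBp : forall eps, (0 < eps)%R ->
    exists N, forall n, (N <= n)%nat -> (Cmod (Bp n) < eps)%R).
  { intros eps Heps.
    destruct (proj1 (is_series_Cmod_eps _ _) HB eps Heps) as [N HN].
    exists (S N). intros [|n] Hn; [lia|]. unfold Bp. rewrite <- sum_n_m_S.
    apply HN. lia. }
  assert (HK : exists K, (0 < K)%R /\ forall n, (Cmod (Bp n) <= K)%R).
  { destruct (filterlim_bounded (V := C_NormedModule) Bp) as [M HM].
    - exists (RtoC 0). apply (proj2 (filterlim_locally_ball_norm (U := C_NormedModule) _ _)).
      intros [eps Heps]. destruct (HBp eps Heps) as [N HN]. exists N.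
      intros n Hn. unfold ball_norm. change (Cmod (Bp n - RtoC 0) < eps)%R.
      replace (Bp n - RtoC 0) with (Bp n) by ring. now apply HN.
    - exists (Rmax M 1). split; [apply Rlt_le_trans with 1%R; [lra|apply Rmax_r]|].
      intro n. eapply Rle_trans; [exact (HM n)|apply Rmax_l]. }
  destruct HK as [K [K0 HK]].
  set (al := fun d => Cmod (a d)).
  set (SA := Series (fun n => al (S n))).
  assert (Hpart : forall n, (sum_n_m al 1 n <= SA)%R).
  { assert (Hp : forall n, (sum_n (fun n => al (S n)) n <= SA)%R).
    { apply (is_lim_seq_incr_compare (sum_n _)); [exact (Series_correct _ HAa)|].
      intro n. rewrite sum_Sn. pose proof (Cmod_ge_0 (a (S (S n)))).
      change (@plus R_AbelianMonoid) with Rplus. unfold al. lra. }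
    intros [|n].
    - rewrite sum_n_m_zero by lia. eapply Rle_trans; [|apply (Hp 0%nat)].
      rewrite sum_O. apply Cmod_ge_0.
    - rewrite <- sum_n_m_S. apply Hp. }
  assert (HSA : (0 <= SA)%R).
  { specialize (Hpart 0%nat). rewrite sum_n_m_zero in Hpart by lia. exact Hpart. }
  assert (Htail : forall eps, (0 < eps)%R -> exists D, forall N, (D <= N)%nat ->
    (sum_n_m al (S D) N <= eps)%R).
  { intros eps Heps.
    destruct (Cauchy_ex_series (V := R_CompleteNormedModule) _ HAa (mkposreal _ Heps)) as [D HD].
    exists (S D). intros N HN.
    destruct (Nat.eq_dec N (S D)) as [->|HN'].
    { rewrite sum_n_m_zero by lia. simpl. change (@zero R_AbelianMonoid) with 0%R. lra. }
    destruct N as [|N]; [lia|]. rewrite <- sum_n_m_S.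
    specialize (HD (S D) N ltac:(lia) ltac:(lia)).
    eapply Rle_trans; [apply Rle_abs|]. apply Rlt_le, HD. }
  apply is_series_Cmod_eps. intros eps Heps.
  (* The three errors below are at most [SA * e], [e * K] and [e * Cmod B], so together less than
     [eps]; the 1 keeps the denominator positive. *)
  set (e := (eps / (2 * (SA + K + Cmod B + 1)))%R).
  pose proof (Cmod_ge_0 B) as HB0.
  assert (He : (0 < e)%R) by (apply Rdiv_lt_0_compat; lra).
  destruct (Htail e He) as [D HD].
  destruct (HBp e He) as [M HM].
  destruct (proj1 (is_series_Cmod_eps _ _) HA e He) as [N0 HN0].
  (* The product makes [S N / d] at least [M] for every [d <= D]; [N0] controls the partial sum of
     [a]. *)
  exists (S D * S M + N0)%nat. intros N HN.
  unfold sum_n. rewrite sum_n_m_S, sum_dirichlet_conv.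
  (* Each partial sum of [b] is [B] plus its error; the constant [B] collects the partial sum of
     [a]. *)
  assert (ES : sum_n_m (G := C_AbelianMonoid)
      (fun d => a d * sum_n_m (G := C_AbelianMonoid) b 1 (S N / d)) 1 (S N) - A * B
    = sum_n_m (G := C_AbelianMonoid) (fun d => a d * Bp (S N / d)%nat) 1 (S N)
      + (sum_n (G := C_AbelianMonoid) (fun n => a (S n)) N - A) * B).
  { unfold sum_n. rewrite sum_n_m_S.
    rewrite (sum_n_m_ext (G := C_AbelianMonoid) _
      (fun d => plus (G := C_AbelianMonoid) (a d * Bp (S N / d)%nat) (a d * B))).
    2: { intro d. unfold Bp. change (@plus C_AbelianMonoid) with Cplus.
         C_ring. }
    rewrite sum_n_m_plus.
    assert (EB : sum_n_m (G := C_AbelianMonoid) (fun d => a d * B) 1 (S N)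
      = sum_n_m (G := C_AbelianMonoid) a 1 (S N) * B)
      by exact (sum_n_m_mult_r (K := C_Ring) B a 1 (S N)).
    rewrite EB. change (@plus C_AbelianMonoid) with Cplus.
    C_ring. }
  eapply Rle_lt_trans.
  { apply Req_le, (f_equal Cmod ES). }
  eapply Rle_lt_trans; [apply Cmod_triangle|]. rewrite Cmod_mult.
  specialize (HN0 N ltac:(lia)).
  assert (H1 : (Cmod (sum_n_m (G := C_AbelianMonoid)
      (fun d => (a d * Bp (S N / d)%nat)%C) 1 (S N)) <= SA * e + e * K)%R).
  { rewrite (sum_n_m_Chasles _ 1 D (S N)) by lia.
    eapply Rle_trans; [apply Cmod_triangle|]. apply Rplus_le_compat.
    - eapply Rle_trans; [exact (norm_sum_n_m (V := C_NormedModule) _ 1 D)|].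
      apply Rle_trans with (sum_n_m (fun d => mult (K := R_Ring) (al d) e) 1 D).
      + apply sum_n_m_le_loc. intros d Hd. change (@mult R_Ring) with Rmult.
        eapply Rle_trans; [apply Req_le, Cmod_mult|]. apply Rmult_le_compat_l; [apply Cmod_ge_0|].
        apply Rlt_le, HM. apply Nat.div_le_lower_bound; [lia|]. nia.
      + rewrite (sum_n_m_mult_r (K := R_Ring) e al).
        apply Rmult_le_compat_r; [lra|apply Hpart].
    - eapply Rle_trans; [exact (norm_sum_n_m (V := C_NormedModule) _ (S D) (S N))|].
      apply Rle_trans with (sum_n_m (fun d => mult (K := R_Ring) (al d) K) (S D) (S N)).
      + apply sum_n_m_le. intro d. change (@mult R_Ring) with Rmult.
        eapply Rle_trans; [apply Req_le, Cmod_mult|]. apply Rmult_le_compat_l; [apply Cmod_ge_0|apply HK].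
      + rewrite (sum_n_m_mult_r (K := R_Ring) K al).
        apply Rmult_le_compat_r; [lra|apply HD; lia]. }
  assert (H2 : (Cmod (sum_n (G := C_AbelianMonoid) (fun n => a (S n)) N - A) * Cmod B
    <= e * Cmod B)%R) by (apply Rmult_le_compat_r; lra).
  assert (H3 : (e * (2 * (SA + K + Cmod B + 1)) = eps)%R) by (unfold e; field; lra).
  nra.
Qed.

(** * The complex exponential: algebra and second-order estimates *)

Lemma Cexp_plus (z w : C) : Cexp (z + w) = Cexp z * Cexp w.
Proof.
  destruct z as [x y], w as [u v]. unfold Cexp, Cplus, Cmult; cbn.
  rewrite exp_plus, cos_plus, sin_plus. f_equal; ring.
Qed.

Lemma Cmod_Cexp (z : C) : Cmod (Cexp z) = exp (Re z).
Proof.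
  unfold Cmod, Cexp; cbn [fst snd].
  replace ((exp (Re z) * cos (Im z)) ^ 2 + (exp (Re z) * sin (Im z)) ^ 2)%R
    with (exp (Re z) * exp (Re z) * ((sin (Im z))² + (cos (Im z))²))%R
    by (unfold Rsqr; ring).
  rewrite sin2_cos2, Rmult_1_r. apply sqrt_square, Rlt_le, exp_pos.
Qed.

Lemma Cmod_nat_cpow (n : nat) (z : C) : Cmod (nat_cpow n z) = exp (Re z * ln (INR n)).
Proof.
  unfold nat_cpow. rewrite Cmod_Cexp. f_equal. destruct z; cbn; ring.
Qed.

Lemma nat_cpow_plus (n : nat) (z w : C) :
  nat_cpow n (z + w) = nat_cpow n z * nat_cpow n w.
Proof. unfold nat_cpow. rewrite <- Cexp_plus. f_equal. ring. Qed.

Lemma nat_cpow_mult (m n : nat) (z : C) : (1 <= m)%nat -> (1 <= n)%nat ->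
  nat_cpow (m * n) z = nat_cpow m z * nat_cpow n z.
Proof.
  intros Hm Hn. unfold nat_cpow. rewrite <- Cexp_plus. f_equal.
  rewrite mult_INR, ln_mult, RtoC_plus by (apply lt_0_INR; lia). ring.
Qed.

Lemma nat_cpow_1 (n : nat) : (1 <= n)%nat -> nat_cpow n 1 = RtoC (INR n).
Proof.
  intro Hn. unfold nat_cpow, Cexp, Cmult, RtoC; cbn.
  replace (1 * ln (INR n) - 0 * 0)%R with (ln (INR n)) by ring.
  replace (1 * 0 + 0 * ln (INR n))%R with 0%R by ring.
  rewrite exp_ln by (apply lt_0_INR; lia). rewrite cos_0, sin_0. f_equal; ring.
Qed.

(** Both signs follow from [1 + t <= exp t]: at [t = - x], multiplied by [exp x], for [x >= 0], and
    at [t = x] for [x < 0]. *)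
Lemma Rabs_exp_sub_1_le (x : R) : (Rabs (exp x - 1) <= Rabs x * exp (Rabs x))%R.
Proof.
  assert (H1 := exp_ineq1_le x). assert (H2 := exp_ineq1_le (- x)).
  assert (H3 := exp_pos x). assert (H4 := exp_pos (- x)).
  assert (H5 : (exp x * exp (- x) = 1)%R)
    by (rewrite <- exp_plus, Rplus_opp_r; apply exp_0).
  destruct (Rle_dec 0 x) as [H|H].
  - rewrite (Rabs_pos_eq x) by lra. rewrite Rabs_pos_eq by lra. nra.
  - rewrite (Rabs_left x) by lra. rewrite Rabs_left1 by nra. nra.
Qed.

(** Multiplying [1 - x <= exp (- x)] by [exp x] gives [exp x - 1 <= x * exp x], hence
    [exp x - 1 - x <= x * (exp x - 1)], whose second factor is again of order [x]. *)
Lemma Rabs_exp_sub_1_sub_le (x : R) :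
  (Rabs (exp x - 1 - x) <= x ^ 2 * exp (Rabs x))%R.
Proof.
  assert (H1 := exp_ineq1_le x). assert (H2 := exp_ineq1_le (- x)).
  assert (H3 := exp_pos x). assert (H4 := exp_pos (- x)).
  assert (H5 : (exp x * exp (- x) = 1)%R)
    by (rewrite <- exp_plus, Rplus_opp_r; apply exp_0).
  rewrite Rabs_pos_eq by lra.
  destruct (Rle_dec 0 x) as [H|H].
  - rewrite (Rabs_pos_eq x) by lra.
    assert (exp x - 1 <= x * exp x)%R by nra. nra.
  - rewrite (Rabs_left x) by lra.
    assert (exp x <= 1)%R by nra.
    assert (exp x - 1 - x <= x ^ 2)%R by nra.
    assert (1 <= exp (- x))%R by lra. nra.
Qed.

Lemma Rabs_sin_le (y : R) : (Rabs (sin y) <= Rabs y)%R.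
Proof.
  destruct (MVT_gen sin 0 y cos) as [c [_ E]].
  - intros x _. apply is_derive_sin.
  - intros x _. apply continuity_sin.
  - rewrite sin_0, !Rminus_0_r in E. rewrite E, Rabs_mult.
    rewrite <- (Rmult_1_l (Rabs y)) at 2.
    apply Rmult_le_compat_r; [apply Rabs_pos|]. apply Rabs_le, COS_bound.
Qed.

Lemma Rabs_1_sub_cos_le (y : R) : (Rabs (1 - cos y) <= y ^ 2)%R.
Proof.
  assert (E : (1 - cos y = 2 * (sin (y / 2))²)%R).
  { replace y with (2 * (y / 2))%R at 1 by field. rewrite cos_2a_sin. unfold Rsqr. ring. }
  rewrite E. rewrite Rabs_pos_eq by (pose proof (Rle_0_sqr (sin (y / 2))); lra).
  pose proof (Rsqr_le_abs_1 _ _ (Rabs_sin_le (y / 2))) as H. 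
  unfold Rsqr in *. nra.
Qed.

(** By the mean value theorem the quotient by [y] is [cos c - 1] with [c] between 0 and [y], hence
    at most [c ^ 2 <= y ^ 2] in absolute value. *)
Lemma Rabs_sin_sub_le (y : R) : (Rabs (sin y - y) <= Rabs y * y ^ 2)%R.
Proof.
  destruct (MVT_gen (fun x => sin x - x)%R 0 y (fun x => cos x - 1)%R) as [c [Hc E]].
  - intros x _. auto_derive; [trivial|ring].
  - intros x _. apply continuity_pt_minus; [apply continuity_sin|apply continuity_pt_id].
  - rewrite sin_0, !Rminus_0_r in E. rewrite E, Rabs_mult, Rmult_comm.
    apply Rmult_le_compat_l; [apply Rabs_pos|].
    rewrite Rabs_minus_sym. eapply Rle_trans; [apply Rabs_1_sub_cos_le|].
    revert Hc. unfold Rmin, Rmax. destruct (Rle_dec 0 y); nra.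
Qed.

Lemma Cmod_le_Rabs_plus (z : C) : (Cmod z <= Rabs (Re z) + Rabs (Im z))%R.
Proof.
  replace z with (RtoC (Re z) + Ci * RtoC (Im z)) at 1
    by (destruct z; unfold RtoC, Ci, Cplus, Cmult; cbn; f_equal; ring).
  eapply Rle_trans; [apply Cmod_triangle|].
  rewrite Cmod_mult, Cmod_Ci, !Cmod_R. lra.
Qed.

Lemma Rabs_Im_le_Cmod (z : C) : (Rabs (Im z) <= Cmod z)%R.
Proof. eapply Rle_trans; [|apply Rmax_Cmod]. apply Rmax_r. Qed.

(** With [r = Cmod z], the real part contributes [r ^ 2 * exp r] and the imaginary part twice that,
    whence the constant 3. This estimate drives the termwise differentiation of [k ^ (-s)]. *)
Lemma Cmod_Cexp_sub_1_sub_le (z : C) :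
  (Cmod (Cexp z - 1 - z) <= 3 * Cmod z ^ 2 * exp (Cmod z))%R.
Proof.
  assert (Hx := re_le_Cmod z). assert (Hy := Rabs_Im_le_Cmod z).
  assert (Hm := Cmod2_alt z). assert (Hz := Cmod_ge_0 z).
  eapply Rle_trans; [apply Cmod_le_Rabs_plus|].
  destruct z as [x y]. set (r := Cmod (x, y)) in *.
  unfold Cexp, Re, Im, Cminus, Cplus, Copp, RtoC in *; cbn [fst snd] in *.
  assert (HE : (exp (Rabs x) <= exp r)%R)
    by (destruct Hx as [Hx|Hx]; [left; now apply exp_increasing|right; now rewrite Hx]).
  assert (Hx0 : (exp x <= exp r)%R).
  { eapply Rle_trans; [|exact HE].
    destruct (Rle_lt_or_eq_dec _ _ (Rle_abs x)) as [H|H];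
      [left; now apply exp_increasing|right; now rewrite <- H]. }
  assert (Hr := exp_ineq1_le r).
  assert (H1 := Rabs_exp_sub_1_le x). assert (H2 := Rabs_exp_sub_1_sub_le x).
  assert (H3 := Rabs_sin_le y). assert (H4 := Rabs_1_sub_cos_le y).
  assert (H5 := Rabs_sin_sub_le y).
  assert (Ax := Rabs_pos x). assert (Ay := Rabs_pos y).
  assert (P := exp_pos x).
  assert (HR : (Rabs (exp x * cos y + - (1) + - x) <= r ^ 2 * exp r)%R).
  { replace (exp x * cos y + - (1) + - x)%R
      with ((exp x - 1 - x) + - (exp x * (1 - cos y)))%R by ring.
    eapply Rle_trans; [apply Rabs_triang|].
    rewrite Rabs_Ropp, Rabs_mult, (Rabs_pos_eq (exp x)) by lra.
    assert (x ^ 2 * exp (Rabs x) <= x ^ 2 * exp r)%R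
      by (apply Rmult_le_compat_l; nra).
    assert (exp x * Rabs (1 - cos y) <= exp r * y ^ 2)%R
      by (apply Rmult_le_compat; [lra|apply Rabs_pos|lra|lra]).
    nra. }
  (* The product of two first-order quantities gives one [r ^ 2 * exp r]; the cubic bound on
     [sin y - y] gives the other, one factor [Rabs y] being at most [exp r]. *)
  assert (HI : (Rabs (exp x * sin y + - 0 + - y) <= 2 * r ^ 2 * exp r)%R).
  { replace (exp x * sin y + - 0 + - y)%R
      with ((exp x - 1) * sin y + (sin y - y))%R by ring.
    eapply Rle_trans; [apply Rabs_triang|]. rewrite Rabs_mult.
    assert (Rabs (exp x - 1) <= r * exp r)%R.
    { eapply Rle_trans; [exact H1|]. apply Rmult_le_compat; try lra.
      apply Rlt_le, exp_pos. }
    assert (Rabs (exp x - 1) * Rabs (sin y) <= (r * exp r) * r)%R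
      by (apply Rmult_le_compat; try apply Rabs_pos; lra).
    assert (Rabs y * y ^ 2 <= exp r * r ^ 2)%R
      by (apply Rmult_le_compat; [lra|nra|lra|nra]).
    nra. }
  nra.
Qed.

(** * Absolute convergence and differentiation of Dirichlet series *)

Lemma ln_INR_ge_0 (n : nat) : (0 <= ln (INR (S n)))%R.
Proof.
  rewrite <- ln_1. apply ln_le; [lra|]. rewrite S_INR. pose proof (pos_INR n). lra.
Qed.

(** At [x = ln k] this reads [ln k <= k ^ d / d]: a logarithmic factor costs an arbitrarily small
    shift of [s]. *)
Lemma le_exp_div (d x : R) : (0 < d)%R -> (x <= / d * exp (d * x))%R.
Proof.
  intro Hd. apply (Rmult_le_reg_l d); [exact Hd|].
  rewrite <- Rmult_assoc, Rinv_r, Rmult_1_l by lra.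
  pose proof (exp_ineq1_le (d * x)). lra.
Qed.

Lemma Cmod_dirichlet_term (a : nat -> C) (s : C) (n : nat) :
  Cmod (dirichlet_term a s n) = (Cmod (a (S n)) * exp (- Re s * ln (INR (S n))))%R.
Proof. unfold dirichlet_term. now rewrite Cmod_mult, Cmod_nat_cpow. Qed.

(** Comparison test: the exponential is the ratio of [Cmod (k ^ (-t))] to [Cmod (k ^ (-s))], with
    [k = S n]. *)
Lemma dirichlet_abs_cv_le (a b : nat -> C) (s t : C) (K : R) :
  (forall n, Cmod (b (S n)) <=
     K * (Cmod (a (S n)) * exp ((Re s - Re t) * ln (INR (S n)))))%R ->
  dirichlet_abs_cv a t -> dirichlet_abs_cv b s.
Proof.
  intros H Ha.
  apply (ex_series_le (V := R_CompleteNormedModule) _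
    (fun n => K * Cmod (dirichlet_term a t n))%R).
  - intro n. change (Rabs (Cmod (dirichlet_term b s n))
      <= K * Cmod (dirichlet_term a t n))%R.
    rewrite Rabs_pos_eq by apply Cmod_ge_0.
    rewrite !Cmod_dirichlet_term.
    replace (- Re t * ln (INR (S n)))%R
      with ((Re s - Re t) * ln (INR (S n)) + - Re s * ln (INR (S n)))%R by ring.
    rewrite exp_plus, <- !Rmult_assoc.
    apply Rmult_le_compat_r; [apply Rlt_le, exp_pos|].
    rewrite Rmult_assoc. apply H.
  - apply (ex_series_scal_l (V := R_NormedModule) K). exact Ha.
Qed.

Lemma dirichlet_is_series (a : nat -> C) (s : C) : dirichlet_abs_cv a s ->
  @is_series C_AbsRing C_NormedModule (dirichlet_term a s) (dirichlet a s).
Proof. apply ex_series_Cmod. Qed.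

Lemma dirichlet_abs_cv_ln (f : nat -> C) (s : C) (sigma : R) :
  (forall w : C, (sigma < Re w)%R -> dirichlet_abs_cv f w) -> (sigma < Re s)%R ->
  dirichlet_abs_cv (fun k => f k * RtoC (ln (INR k))) s.
Proof.
  (* Half the distance to the line [Re = sigma], so that [s - d] stays in the half-plane of
     convergence. *)
  intros H Hs. set (d := ((Re s - sigma) / 2)%R).
  assert (Hd : (0 < d)%R) by (unfold d; lra).
  apply (dirichlet_abs_cv_le f _ s (s - RtoC d) (/ d)).
  - intro n. rewrite Cmod_mult, Cmod_R, Rabs_pos_eq by apply ln_INR_ge_0.
    replace (Re s - Re (s - RtoC d))%R with d by (destruct s; cbn; ring).
    rewrite (Rmult_comm (/ d)), Rmult_assoc, (Rmult_comm _ (/ d)).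
    apply Rmult_le_compat_l; [apply Cmod_ge_0|]. now apply le_exp_div.
  - apply H. destruct s; cbn in *. unfold d. lra.
Qed.

(* With [h = w - s], the remainder is the series of
   [f k * k^(-s) * (exp (-h ln k) - 1 + h ln k)], bounded termwise by
   [3 |h|^2 |f k| (ln k)^2 k^(d - Re s)] when [|h| <= d]. *)
Lemma is_derive_dirichlet (f : nat -> C) (s : C) (sigma : R) :
  (forall w : C, (sigma < Re w)%R -> dirichlet_abs_cv f w) -> (sigma < Re s)%R ->
  @is_derive C_AbsRing C_NormedModule (dirichlet f) s
    (- dirichlet (fun k => f k * RtoC (ln (INR k))) s).
Proof.
  (* Small enough that [s - d] and every [w] within [d] of [s] have real part above [sigma]. *)
  intros H Hs. set (d := ((Re s - sigma) / 4)%R).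
  assert (Hd : (0 < d)%R) by (unfold d; lra).
  set (f1 := fun k => f k * RtoC (ln (INR k))).
  set (f2 := fun k => f1 k * RtoC (ln (INR k))).
  assert (Hf1 : forall w, (sigma < Re w)%R -> dirichlet_abs_cv f1 w)
    by (intros w; now apply dirichlet_abs_cv_ln).
  assert (Hf2 : dirichlet_abs_cv f2 (s - RtoC d)).
  { apply (dirichlet_abs_cv_ln f1 _ sigma Hf1).
    destruct s; cbn in *. unfold d. lra. }
  set (M := Series (fun n => Cmod (dirichlet_term f2 (s - RtoC d) n))).
  assert (HM : (0 <= M)%R).
  { apply Rle_trans with (Cmod (dirichlet f2 (s - RtoC d))); [apply Cmod_ge_0|].
    eapply is_series_Cmod_le; [now apply dirichlet_is_series| |exact Hf2].
    intro n; apply Rle_refl. }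
  assert (key : forall w, (Cmod (w - s) <= d)%R ->
    (Cmod (dirichlet f w - dirichlet f s - (w - s) * (- dirichlet f1 s))
      <= 3 * Cmod (w - s) ^ 2 * M)%R).
  { intros w Hw. set (h := w - s) in *.
    assert (Hrw : (sigma < Re w)%R).
    { pose proof (re_le_Cmod h) as Hr. apply Rabs_le_between in Hr.
      assert (Re w = Re s + Re h)%R by (unfold h; destruct s, w; cbn; ring).
      unfold d in *. lra. }
    unfold M. rewrite <- Series_scal_l.
    eapply (is_series_Cmod_le (fun n => dirichlet_term f w n - dirichlet_term f s n
        - h * (- dirichlet_term f1 s n))).
    - apply (is_series_minus (V := C_NormedModule)
        (fun n => dirichlet_term f w n - dirichlet_term f s n)
        (fun n => h * (- dirichlet_term f1 s n))).
      + apply (is_series_minus (V := C_NormedModule)); apply dirichlet_is_series; auto.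
      + apply (is_series_scal (V := C_NormedModule) h
          (fun n => - dirichlet_term f1 s n)).
        apply (is_series_opp (V := C_NormedModule) (dirichlet_term f1 s)).
        apply dirichlet_is_series; auto.
    - intro n. unfold dirichlet_term, f2, f1. set (k := S n).
      assert (Hk : (0 <= ln (INR k))%R) by apply ln_INR_ge_0.
      replace (- w) with (- s + - h) by (unfold h; ring).
      rewrite nat_cpow_plus.
      (* Factoring out [f k * k ^ (-s)] exposes the second-order remainder of [Cexp] at
         [- h ln k]. *)
      replace (f k * (nat_cpow k (- s) * nat_cpow k (- h)) - f k * nat_cpow k (- s)
          - h * - (f k * RtoC (ln (INR k)) * nat_cpow k (- s)))
        with (f k * nat_cpow k (- s)
          * (nat_cpow k (- h) - 1 - (- h) * RtoC (ln (INR k)))) by ring.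
      rewrite !Cmod_mult, !Cmod_nat_cpow, !Cmod_R, !(Rabs_pos_eq (ln (INR k))) by exact Hk.
      replace (Re (- (s - RtoC d)) * ln (INR k))%R
        with (Re (- s) * ln (INR k) + d * ln (INR k))%R
        by (destruct s; cbn; ring).
      rewrite exp_plus.
      assert (B := Cmod_Cexp_sub_1_sub_le (- h * RtoC (ln (INR k)))).
      rewrite Cmod_mult, Cmod_opp, Cmod_R, (Rabs_pos_eq (ln (INR k))) in B by exact Hk.
      change (Cexp (- h * RtoC (ln (INR k)))) with (nat_cpow k (- h)) in B.
      assert (Hh := Cmod_ge_0 h).
      assert (B2 : (exp (Cmod h * ln (INR k)) <= exp (d * ln (INR k)))%R).
      { destruct (Rle_lt_or_eq_dec (Cmod h * ln (INR k)) (d * ln (INR k))) as [L|L].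
        - now apply Rmult_le_compat_r.
        - left; now apply exp_increasing.
        - right; now rewrite L. }
      assert (B3 : (3 * (Cmod h * ln (INR k)) ^ 2 * exp (Cmod h * ln (INR k))
        <= 3 * (Cmod h * ln (INR k)) ^ 2 * exp (d * ln (INR k)))%R).
      { apply Rmult_le_compat_l; [|exact B2].
        pose proof (pow2_ge_0 (Cmod h * ln (INR k))). lra. }
      eapply Rle_trans.
      { apply Rmult_le_compat_l; [|exact (Rle_trans _ _ _ B B3)].
        apply Rmult_le_pos; [apply Cmod_ge_0|apply Rlt_le, exp_pos]. }
      right; ring.
    - apply (ex_series_scal_l (V := R_NormedModule)). exact Hf2. }
  split.
  - apply (is_linear_scal_l (K := C_AbsRing) (V := C_NormedModule)).
  (* The differential is tested at every limit [x] of the neighbourhood filter of [s]; the only one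
     is [s]. *)
  - intros x Hx.
    apply (is_filter_lim_locally_unique (V := AbsRing_NormedModule C_AbsRing)) in Hx.
    subst x. intros [eps Heps].
    apply (locally_le_locally_norm (V := AbsRing_NormedModule C_AbsRing)).
    (* Below [d] the bound [key] applies; below the other term [3 * M * Cmod (w - s) <= eps]. The 1
       covers [M = 0]. *)
    assert (Hr : (0 < Rmin d (eps / (3 * M + 1)))%R).
    { apply Rmin_pos; [exact Hd|apply Rdiv_lt_0_compat; lra]. }
    exists (mkposreal _ Hr). intros w Hw.
    change (Cmod (w - s) < Rmin d (eps / (3 * M + 1)))%R in Hw.
    change (Cmod (dirichlet f w - dirichlet f s - (w - s) * (- dirichlet f1 s))
      <= eps * Cmod (w - s))%R.
    assert (W1 := Rlt_le_trans _ _ _ Hw (Rmin_l _ _)).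
    assert (W2 := Rlt_le_trans _ _ _ Hw (Rmin_r _ _)).
    eapply Rle_trans; [apply key; lra|].
    assert (Hh := Cmod_ge_0 (w - s)).
    assert (E : (eps / (3 * M + 1) * (3 * M + 1) = eps)%R) by (field; lra).
    replace (3 * Cmod (w - s) ^ 2 * M)%R
      with ((Cmod (w - s) * (3 * M)) * Cmod (w - s))%R by ring.
    apply Rmult_le_compat_r; [exact Hh|]. nra.
Qed.

(** * Dirichlet series of convolutions, the series of [g L], and the identity *)

(** The map [k -> k ^ (-s)] is completely multiplicative, so it distributes over [n = d (n / d)];
    this reduces products of Dirichlet series to the product theorem for plain series. *)
Lemma dirichlet_term_dirichlet_conv (a b : nat -> C) (s : C) (n : nat) :
  dirichlet_term (dirichlet_conv a b) s n
  = dirichlet_conv (fun k => a k * nat_cpow k (- s)) (fun k => b k * nat_cpow k (- s)) (S n).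
Proof.
  unfold dirichlet_term, dirichlet_conv.
  etransitivity; [symmetry; exact (sum_n_m_mult_r (K := C_Ring) _ _ 1 (S n))|].
  apply sum_n_m_ext_loc. intros d Hd.
  destruct (Nat.eqb_spec (S n mod d) 0) as [E|E].
  - assert (Q := Nat.div_mod_eq (S n) d).
    assert (Q1 : S n = (d * (S n / d))%nat) by lia.
    rewrite Q1 at 2. rewrite nat_cpow_mult by nia.
    change (@mult C_Ring) with Cmult.
    C_ring.
  - apply (mult_zero_l (K := C_Ring)).
Qed.

Lemma is_series_dirichlet_term_conv (a b : nat -> C) (s : C) :
  dirichlet_abs_cv a s -> dirichlet_abs_cv b s ->
  @is_series C_AbsRing C_NormedModule (dirichlet_term (dirichlet_conv a b) s)
    (dirichlet a s * dirichlet b s).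
Proof.
  intros Ha Hb.
  eapply is_series_ext; [intro n; symmetry; apply dirichlet_term_dirichlet_conv|].
  apply (is_series_dirichlet_conv (fun k => a k * nat_cpow k (- s))
    (fun k => b k * nat_cpow k (- s))).
  - exact (dirichlet_is_series a s Ha).
  - exact Ha.
  - exact (dirichlet_is_series b s Hb).
Qed.

Lemma dirichlet_term_mul_id (g : nat -> C) (s : C) (n : nat) :
  dirichlet_term (fun k => g k * RtoC (INR k)) s n = dirichlet_term g (s - 1) n.
Proof.
  unfold dirichlet_term.
  replace (- (s - 1)) with (1 + - s) by ring.
  rewrite nat_cpow_plus, nat_cpow_1 by lia. ring.
Qed.

(** Each of the [k] terms lies between 0 and [ln k]. *)
Lemma log_sum_bounds (k : nat) : (0 <= log_sum k <= INR k * ln (INR k))%R.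
Proof.
  unfold log_sum. split.
  - replace 0%R with (sum_n_m (fun _ => 0%R) 1 k)
      by exact (sum_n_m_const_zero (G := R_AbelianMonoid) 1 k).
    apply sum_n_m_le_loc. intros [|m] Hm; [lia|apply ln_INR_ge_0].
  - replace (INR k * ln (INR k))%R with (sum_n_m (fun _ => ln (INR k)) 1 k)
      by (rewrite sum_n_m_const; do 2 f_equal; lia).
    apply sum_n_m_le_loc. intros m Hm.
    apply ln_le; [apply lt_0_INR; lia|apply le_INR; lia].
Qed.

(** In [L(k) <= k ln k] the factor [k] shifts the abscissa by 1, and the factor [ln k] does not move
    it. *)
Lemma dirichlet_abs_cv_log_sum (g : nat -> C) (s : C) (sigma : R) :
  (forall w : C, (sigma < Re w)%R -> dirichlet_abs_cv g w) -> (sigma + 1 < Re s)%R ->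
  dirichlet_abs_cv (fun k => g k * RtoC (log_sum k)) s.
Proof.
  intros H Hs.
  assert (H1 : dirichlet_abs_cv (fun k => g k * RtoC (ln (INR k))) (s - 1)).
  { apply (dirichlet_abs_cv_ln _ _ sigma H). destruct s; cbn in *; lra. }
  revert H1. apply (dirichlet_abs_cv_le _ _ _ _ 1).
  intro n. destruct (log_sum_bounds (S n)) as [L1 L2].
  rewrite !Cmod_mult, !Cmod_R, (Rabs_pos_eq (log_sum _)) by exact L1.
  rewrite Rabs_pos_eq by apply ln_INR_ge_0.
  replace (Re s - Re (s - 1))%R with 1%R by (destruct s; cbn; ring).
  rewrite !Rmult_1_l, exp_ln by (apply lt_0_INR; lia).
  rewrite Rmult_assoc. apply Rmult_le_compat_l; [apply Cmod_ge_0|]. lra.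
Qed.

Theorem theorem6 (f g : nat -> C) (sigma1 sigma2 alpha : R)
  (hF : forall s : C, (sigma1 < Re s)%R -> dirichlet_abs_cv f s)
  (hG : forall s : C, (sigma2 < Re s)%R -> dirichlet_abs_cv g s)
  (hU : forall s : C, (alpha < Re s)%R -> dirichlet_abs_cv (u_sum f g) s) :
  let gL := fun k : nat => g k * RtoC (log_sum k) in
  (forall s : C, (sigma2 + 1 < Re s)%R -> dirichlet_abs_cv gL s) /\
  (forall s : C, (Rmax alpha (Rmax sigma1 (sigma2 + 1)) < Re s)%R ->
     @ex_derive C_AbsRing C_NormedModule (dirichlet f) s /\
     dirichlet (u_sum f g) s =
       - C_derive (dirichlet f) s * dirichlet g (s - 1)
       + dirichlet f s * dirichlet gL s).
Proof.
  intro gL.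
  assert (hL : forall s : C, (sigma2 + 1 < Re s)%R -> dirichlet_abs_cv gL s)
    by (intro s; now apply dirichlet_abs_cv_log_sum).
  split; [exact hL|]. intros s Hs.
  assert (Hs1 : (sigma1 < Re s)%R).
  { eapply Rle_lt_trans; [|exact Hs].
    eapply Rle_trans; [apply Rmax_l|apply Rmax_r]. }
  assert (Hs2 : (sigma2 + 1 < Re s)%R).
  { eapply Rle_lt_trans; [|exact Hs].
    eapply Rle_trans; [apply Rmax_r|apply Rmax_r]. }
  assert (HD := is_derive_dirichlet f s sigma1 hF Hs1).
  split; [eexists; exact HD|].
  rewrite (is_C_derive_unique _ _ _ HD).
  set (gid := fun k => g k * RtoC (INR k)).
  assert (Hg1 : dirichlet_abs_cv g (s - 1)).
  { apply hG. destruct s; cbn in *; lra. }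
  assert (Hgid : dirichlet_abs_cv gid s).
  { eapply ex_series_ext; [|exact Hg1]. intro n. cbv beta.
    now rewrite <- dirichlet_term_mul_id. }
  assert (Egid : dirichlet g (s - 1) = dirichlet gid s).
  { symmetry. apply CSeries_correct.
    eapply is_series_ext; [intro n; symmetry; apply dirichlet_term_mul_id|].
    now apply dirichlet_is_series. }
  rewrite Egid. apply CSeries_correct.
  replace (- - dirichlet (fun k => f k * RtoC (ln (INR k))) s)
    with (dirichlet (fun k => f k * RtoC (ln (INR k))) s) by ring.
  (* Each term splits into the terms of the two convolutions, whose series converge to the two
     products. *)
  eapply is_series_ext;
    [|apply (is_series_plus (V := C_NormedModule)); apply is_series_dirichlet_term_conv].
  - intro n. unfold dirichlet_term. rewrite u_sum_dirichlet_conv.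
    symmetry. exact (Cmult_plus_distr_r _ _ _).
  - exact (dirichlet_abs_cv_ln f s sigma1 hF Hs1).
  - exact Hgid.
  - exact (hF s Hs1).
  - exact (hL s Hs2).
Qed.
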